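(* Let $A$ be an $m\times m$ nonnegative definite hermitian matrix. Then, for all $I,J\subset[m]$, $$\operatorname{tr} A[I]^p+\operatorname{tr} A[J]^p\ \ge\ \operatorname{tr} A[I\cup J]^p+\operatorname{tr} A[I\cap J]^p\quad\text{for } 0\le p\le 1,$$ $$\operatorname{tr} A[I]^p+\operatorname{tr} A[J]^p\ \le\ \operatorname{tr} A[I\cup J]^p+\operatorname{tr} A[I\cap J]^p\quad\text{for } 1\le p\le 2,$$ and $$\operatorname{tr}\big(A[I]\log A[I]\big)+\operatorname{tr}\big(A[J]\log A[J]\big)\ \le\ \operatorname{tr}\big(A[I\cup J]\log A[I\cup J]\big)+\operatorname{tr}\big(A[I\cap J]\log A[I\cap J]\big).$$
   Context: $[m]=\{1,\dots,m\}$. For $I\subset[m]$, $A[I]$ is the principal submatrix of $A$ with rows and columns indexed by $I$, and $A[I]^p$ means $(A[I])^p$. Functions of hermitian matrices are defined by the spectral functional calculus; $A\log A$ is $f(A)$ with $f(t)=t\log t$, $f(0)=0$. The convention $A^0:=\lim_{p\searrow 0}A^p$ is used for nonnegative definite $A$, so that $\operatorname{tr} A^0=\operatorname{rank} A$. The trace of any function of $A[\emptyset]$ is $0$. *)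

(* Defs.v *)
From HB Require Import structures.
From mathcomp Require Import all_boot all_order all_algebra.
From mathcomp Require Import complex.
From mathcomp Require Import all_classical all_reals all_analysis.
Import numFieldNormedType.Exports.

Set Implicit Arguments.
Unset Strict Implicit.
Unset Printing Implicit Defensive.

Import Order.TTheory GRing.Theory Num.Theory.
Local Open Scope ring_scope.
Local Open Scope complex_scope.
Local Open Scope classical_set_scope.
Local Open Scope sesquilinear_scope.

(* The library gives every [numClosedFieldType] the topology of its norm, but
   not the concrete type [R[i]]. *)
HB.instance Definition _ (R : rcfType) :=
  PseudoPointedMetric.copy R[i] (R[i])^o.

Definition nonneg_definite (R : realType) (m : nat) (A : 'M[R[i]]_m) : Prop :=
  A \is hermsymmx /\ forall x : 'cV[R[i]]_m, 0 <= (x ^t* *m A *m x) 0 0.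

Definition principal_submx (R : realType) (m : nat) (A : 'M[R[i]]_m)
    (I : {set 'I_m}) : 'M[R[i]]_#|I| :=
  mxsub (fun i : 'I_#|I| => enum_val i) (fun j : 'I_#|I| => enum_val j) A.

(* [A = P^-1 D P] with [P := spectralmx A] unitary and [D] diagonal with
   diagonal [spectral_diag A]. The eigenvalues of a hermitian matrix are real,
   so that taking their real parts loses nothing there. *)
Definition mxfun (R : realType) (f : R -> R) (n : nat) (A : 'M[R[i]]_n) :
    'M[R[i]]_n :=
  invmx (spectralmx A)
  *m diag_mx (map_mx (fun z : R[i] => (f (complex.Re z))%:C) (spectral_diag A))
  *m spectralmx A.

(* The case [p = 0] cannot be [mxfun (powR^~ 0)]: since [0 `^ 0 = 1], that is
   the identity matrix even when [A] is singular. *)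
Definition mxpowR (R : realType) (n : nat) (A : 'M[R[i]]_n) (p : R) :
    'M[R[i]]_n :=
  if p == 0 then lim (mxfun (fun t => t `^ q) A @[q --> (0 : R)^'+])
  else mxfun (fun t => t `^ p) A.

(* [t * ln t] is [0] at [t = 0], whatever [ln 0] is. *)
Definition mxxlogx (R : realType) (n : nat) (A : 'M[R[i]]_n) : 'M[R[i]]_n :=
  mxfun (fun t => t * ln t) A.

(* Main.v *)
Require Import Defs.
From mathcomp Require Import all_boot all_order all_algebra.
From mathcomp Require Import complex ring lra.
From mathcomp Require Import all_classical all_reals all_analysis.
Import numFieldNormedType.Exports.

(** Write [xs] for the eigenvalues of [A[I :|: J]] and [A[I :&: J]] together,
    and [ys] for those of [A[I]] and [A[J]]. All the traces are sums of a
    function over these two lists of nonnegative reals, so the theorem compares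
    [\sum_(x <- xs) f x] with [\sum_(x <- ys) f x] for several functions [f].
    The trace is modular, so linear functions give equal sums. The one
    inequality that comes from linear algebra is that
    [I |-> \det (1 + s A[I])] is log-submodular for every [s >= 0], that is,
    the functions [ln (1 + s x)] have a larger sum over [ys]
    ([log_det_submodular]). Everything else follows from the fact that [x `^ p]
    is a limit of positive combinations of the functions [ln (1 + s x)], when
    [0 < p < 1], and of the functions [s x - ln (1 + s x)], when [1 < p < 2].

    Log-submodularity. By Sylvester's identity [\det (1 + A[I])] equals
    [\det (1 + A D_I)], with [D_I] the diagonal projection on the coordinates
    in [I]; so all the minors are determinants of one size. Put
    [S := (1 + A D_K)^-1 A]. It is again nonnegative definite, and
    [\det (1 + A D_(K :|: L)) = \det (1 + A D_K) * \det (1 + S D_L)] for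
    disjoint [K] and [L]. Hence adjoining the index [i] to [K] multiplies the
    determinant by [1 + S i i]; and the diagonal of [S] decreases when [K] grows
    ([swept_diag_le]). These decreasing ratios are submodularity.

    Powers as positive combinations. The usual integral
    [\int s^(p-1) h (x / s) ds], which is proportional to [x^p] by the
    substitution [s := x u], is replaced by a series over the powers of a base
    [q > 1]: [G x := \sum_(k : int) q^(-pk) h (q^k x)] satisfies
    [G (q x) = q^p G x] and is monotone, so it agrees with [G 1 * x^p] up to a
    factor [q^p]. Letting [q] tend to [1] gives the comparison for [x^p] from
    the comparisons for all [h (s x)] ([powR_sum_le_of_scaling]).

    The exponents [0] and [2] and the function [x ln x] are limits of the
    previous cases: [x^p] tends to the indicator of [x != 0] when [p] decreases
    to [0], and [(x^p - x) / (p - 1)] tends to [x ln x] when [p] decreases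
    to [1]. *)

Set Implicit Arguments.
Unset Strict Implicit.
Unset Printing Implicit Defensive.
Import Order.TTheory GRing.Theory Num.Theory.
Local Open Scope ring_scope.

(** * Comparing sums of powers *)

Section FiniteSums.
Local Open Scope classical_set_scope.

Lemma cvg_sum_seq (K : numFieldType) (V : normedModType K) (I : eqType)
    (T : Type) (F : set_system T) {FF : Filter F} (f : T -> I -> V) (g : I -> V)
    (r : seq I) :
  (forall i, i \in r -> f t i @[t --> F] --> g i) ->
  (\sum_(i <- r) f t i) @[t --> F] --> \sum_(i <- r) g i.
Proof.
elim: r => [|i r IH] fg.
  rewrite big_nil; under eq_fun do rewrite big_nil; exact: cvg_cst.
rewrite big_cons; under eq_fun do rewrite big_cons.
apply: cvgD; first by apply: fg; rewrite mem_head.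
by apply: IH => j jr; apply: fg; rewrite inE jr orbT.
Qed.

End FiniteSums.

Section Scale.
Variable R : realType.
Local Open Scope classical_set_scope.
Implicit Types (h : R -> R) (c r t a p q x y : R) (xs ys : seq R).

(** Half of the bilateral series [G]: it is used with [r := q], [c := q^-p] for
    the nonnegative powers of [q], and with [r := q^-1], [c := q^p] for the
    others. *)
Definition scale_term h c r t : R^nat := fun k => c ^+ k * h (r ^+ k * t).
Definition scale_sum h c r t : R := limn (series (scale_term h c r t)).

Section Kernel.
Variables (h : R -> R).
Hypotheses (h_ge0 : forall x, 0 <= x -> 0 <= h x)
  (h_homo : forall x y, 0 <= x -> x <= y -> h x <= h y).

Section OneSided.
Variables (c r a C : R).
Hypotheses (c0 : 0 < c) (r0 : 0 < r) (cra : c * r `^ a < 1).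
Hypothesis (hC : forall x, 0 <= x -> h x <= C * x `^ a).

Lemma scale_term_ge0 t k : 0 <= t -> 0 <= scale_term h c r t k.
Proof.
move=> t0; rewrite mulr_ge0 ?exprn_ge0 ?(ltW c0) // h_ge0 // mulr_ge0 //.
by rewrite exprn_ge0 // ltW.
Qed.

(** The bound [h x <= C x^a] makes the terms geometric of ratio [c * r^a]. *)
Lemma is_cvg_scale_sum t : 0 <= t -> cvgn (series (scale_term h c r t)).
Proof.
move=> t0; have tk k : 0 <= r ^+ k * t by rewrite mulr_ge0 ?exprn_ge0 ?(ltW r0).
have C1 : h 1 <= C by have := hC ler01; rewrite powR1 mulr1.
have C0 : 0 <= C by apply: le_trans C1; rewrite h_ge0.
apply: (@series_le_cvg _ _ (geometric (C * t `^ a) (c * r `^ a))).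
- by move=> k; exact: scale_term_ge0.
- move=> k; rewrite /geometric /= mulr_ge0 ?mulr_ge0 ?powR_ge0 // exprn_ge0 //.
  by rewrite mulr_ge0 ?powR_ge0 // ltW.
- move=> k; rewrite /geometric /= exprMn mulrCA; apply: ler_wpM2l.
    by rewrite exprn_ge0 // ltW.
  apply: le_trans (hC (tk k)) _; rewrite powRM ?exprn_ge0 ?(ltW r0) //.
  by rewrite -(powR_mulrn k (ltW r0)) powRAC powR_mulrn ?powR_ge0 //
     mulrA mulrAC.
- apply: is_cvg_geometric_series.
  by rewrite ger0_norm // mulr_ge0 ?powR_ge0 // ltW.
Qed.

Lemma scale_sum_shift t : 0 <= t ->
  scale_sum h c r t = h t + c * scale_sum h c r (r * t).
Proof.
move=> t0; have rt0 : 0 <= r * t by rewrite mulr_ge0 // ltW.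
apply/(cvg_lim (@Rhausdorff R)); rewrite -(cvg_shiftS (series _)).
have -> : [sequence series (scale_term h c r t) n.+1]_n =
  (fun n => h t + c * series (scale_term h c r (r * t)) n).
  apply/funext => n.
  rewrite !seriesEord /= big_ord_recl /scale_term !expr0 !mul1r.
  congr (_ + _); rewrite mulr_sumr; apply: eq_bigr => i _.
  by rewrite lift0 exprS exprSr !mulrA.
apply: cvgD; first exact: cvg_cst.
by apply: cvgMr; exact: is_cvg_scale_sum.
Qed.

Lemma scale_sum_ge t : 0 <= t -> h t <= scale_sum h c r t.
Proof.
move=> t0; rewrite scale_sum_shift // lerDl mulr_ge0 ?(ltW c0) //.
have rt0 : 0 <= r * t by rewrite mulr_ge0 // ltW.
apply: limr_ge; first exact: is_cvg_scale_sum.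
by apply: nearW => n; apply: sumr_ge0 => k _; exact: scale_term_ge0.
Qed.

Lemma scale_sum_homo s t : 0 <= s -> s <= t ->
  scale_sum h c r s <= scale_sum h c r t.
Proof.
move=> s0 st; apply: lim_series_le; try apply: is_cvg_scale_sum => //.
  exact: le_trans st.
move=> k; apply: ler_wpM2l; first by rewrite exprn_ge0 // ltW.
have rk : 0 <= r ^+ k by rewrite exprn_ge0 // ltW.
by apply: h_homo; [exact: mulr_ge0|exact: ler_wpM2l].
Qed.

Lemma scale_sum_le xs ys :
  {in xs, forall x, 0 <= x} -> {in ys, forall x, 0 <= x} ->
  (forall s, 0 < s -> \sum_(x <- xs) h (s * x) <= \sum_(x <- ys) h (s * x)) ->
  \sum_(x <- xs) scale_sum h c r x <= \sum_(x <- ys) scale_sum h c r x.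
Proof.
move=> xs0 ys0 hle.
have cv zs : {in zs, forall x, 0 <= x} ->
   (\sum_(x <- zs) series (scale_term h c r x) n) @[n --> \oo] -->
   \sum_(x <- zs) scale_sum h c r x.
  by move=> zs0; apply: (@cvg_sum_seq R R^o) => x /zs0; exact: is_cvg_scale_sum.
apply: ler_cvg_to (cv _ xs0) (cv _ ys0) _; apply: nearW => n.
rewrite /series /= exchange_big [leRHS]exchange_big /=.
apply: ler_sum => k _; rewrite -!mulr_sumr.
by rewrite ler_pM2l ?exprn_gt0 // hle ?exprn_gt0.
Qed.
End OneSided.

Section TwoSided.
Variables (p a b Ca Cb : R).
Hypotheses (p0 : 0 < p) (ap : a < p) (pb : p < b) (h1 : 0 < h 1).
Hypothesis (hCa : forall x, 0 <= x -> h x <= Ca * x `^ a).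
Hypothesis (hCb : forall x, 0 <= x -> h x <= Cb * x `^ b).

Section Base.
Variable q : R.
Hypothesis q1 : 1 < q.
Let Q := q `^ p.

(** The first sum runs over the powers [q^k] with [k >= 0], the second one over
    those with [k < 0]; the leading factors of the latter account for its
    starting at [k = -1]. *)
Definition bilateral t : R :=
  scale_sum h (q `^ p)^-1 q t + q `^ p * scale_sum h (q `^ p) q^-1 (q^-1 * t).

Let q0 : 0 < q. Proof. exact: lt_trans q1. Qed.
Let Q1 : 1 < Q.
Proof. by rewrite /Q /powR gt_eqF // expR_gt1 mulr_gt0 // ln_gt0. Qed.
Let Q0 : 0 < Q. Proof. exact: lt_trans Q1. Qed.

Let up : Q^-1 * q `^ a < 1.
Proof.
rewrite mulrC ltr_pdivrMr // mul1r /Q /powR gt_eqF // ltr_expR.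
by rewrite ltr_pM2r ?ln_gt0.
Qed.

Let down : Q * q^-1 `^ b < 1.
Proof.
rewrite /Q /powR invr_eq0 gt_eqF // -expRD lnV ?posrE // mulrN -mulrBl expR_lt1.
by rewrite pmulr_llt0 ?ln_gt0 // subr_lt0.
Qed.

Let Qi0 : 0 < Q^-1. Proof. by rewrite invr_gt0. Qed.
Let qi0 : 0 < q^-1. Proof. by rewrite invr_gt0. Qed.

(** Replacing [t] by [q t] shifts the index of summation by one: the term for
    [k = 0] leaves the first sum and enters the second one. *)
Lemma bilateral_scale t : 0 <= t -> bilateral (q * t) = Q * bilateral t.
Proof.
move=> t0; rewrite /bilateral mulKf ?gt_eqF // -/Q.
rewrite (scale_sum_shift Qi0 q0 up hCa t0).
rewrite (scale_sum_shift Q0 qi0 down hCb t0).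
by rewrite !mulrDr mulVKf ?gt_eqF // addrCA addrA.
Qed.

Lemma bilateral_homo s t : 0 <= s -> s <= t -> bilateral s <= bilateral t.
Proof.
move=> s0 st; apply: lerD; first exact: (scale_sum_homo Qi0 q0 up hCa).
apply: ler_wpM2l; first exact: ltW.
apply: (scale_sum_homo Q0 qi0 down hCb); first by rewrite mulr_ge0 // ltW.
by apply: ler_wpM2l => //; exact: ltW.
Qed.

Lemma bilateral1_gt0 : 0 < bilateral 1.
Proof.
have qi1 : 0 <= q^-1 * 1 by rewrite mulr1 ltW.
rewrite ltr_pwDl //.
  exact: lt_le_trans (scale_sum_ge Qi0 q0 up hCa ler01).
rewrite mulr_ge0 ?(ltW Q0) //.
exact: le_trans (h_ge0 qi1) (scale_sum_ge Q0 qi0 down hCb qi1).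
Qed.

Lemma bilateral0 : bilateral 0 = 0.
Proof.
have := bilateral_scale (lexx 0); rewrite mulr0 => e.
have /eqP : (Q - 1) * bilateral 0 = 0 by rewrite mulrBl mul1r -e subrr.
by rewrite mulf_eq0 subr_eq0 gt_eqF //= => /eqP.
Qed.

Lemma bilateral_exprz (j : int) : bilateral (q ^ j) = Q ^ j * bilateral 1.
Proof.
have nat_case n t : 0 <= t -> bilateral (q ^+ n * t) = Q ^+ n * bilateral t.
  move=> t0; elim: n => [|n IH]; first by rewrite !expr0 !mul1r.
  by rewrite !exprS -!mulrA bilateral_scale ?IH // mulr_ge0 ?exprn_ge0
     ?(ltW q0).
case: j => n; first by rewrite -[q ^ _]mulr1 nat_case.
rewrite NegzE -!exprnN.
have e : q ^+ n.+1 * q ^- n.+1 = 1 by rewrite mulfV // expf_neq0 // gt_eqF.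
rewrite -[in RHS]e nat_case ?invr_ge0 ?exprn_ge0 ?(ltW q0) // mulKf //.
by rewrite expf_neq0 // gt_eqF.
Qed.

Lemma exprz_bracket t : 0 < t -> exists j : int, q ^ j <= t <= q ^ (j + 1).
Proof.
move=> t0; have lq : 0 < ln q by rewrite ln_gt0.
have E (k : int) : q ^ k = expR (k%:~R * ln q).
  by rewrite -powR_intmul ?ltW // /powR gt_eqF.
exists (Num.floor (ln t / ln q)); set u := ln t / ln q.
have -> : t = expR (u * ln q) by rewrite divfK ?gt_eqF // lnK.
rewrite !E !ler_expR !ler_pM2r // real_floor_le ?num_real //=.
by rewrite ltW // real_floorD1_gt ?num_real.
Qed.

(** Between two consecutive powers of [q] both [bilateral] and [x `^ p] are
    monotone, and they are proportional at the two ends, whose values differ by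
    the factor [q `^ p]. *)
Lemma bilateral_powR t : 0 <= t ->
  bilateral t <= Q * bilateral 1 * t `^ p /\
  bilateral 1 * t `^ p <= Q * bilateral t.
Proof.
have g0 := bilateral1_gt0; rewrite le_eqVlt => /predU1P[<-|t0].
  by rewrite bilateral0 powR0 ?gt_eqF // !mulr0.
have [j /andP[jt tj]] := exprz_bracket t0.
have qz (k : int) : 0 < q ^ k by rewrite exprz_gt0.
have powz k : (q ^ k) `^ p = Q ^ k.
  by rewrite -(powR_intmul k (ltW q0)) -(powR_intmul k (ltW Q0)) powRAC.
have Qs : Q ^ (j + 1) = Q * Q ^ j by rewrite expfzDr ?gt_eqF // expr1z mulrC.
have lo : Q ^ j <= t `^ p.
  by rewrite -powz ge0_ler_powR ?nnegrE ?(ltW p0) ?(ltW t0) ?(ltW (qz _)).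
have hi : t `^ p <= Q * Q ^ j.
  by rewrite -Qs -powz ge0_ler_powR ?nnegrE ?(ltW p0) ?(ltW t0) ?(ltW (qz _)).
split.
  apply: le_trans (bilateral_homo (ltW t0) tj) _.
  rewrite bilateral_exprz Qs mulrAC.
  by apply: ler_wpM2l => //; rewrite mulr_ge0 // ltW.
rewrite mulrC; apply: le_trans (ler_wpM2r (ltW g0) hi) _.
rewrite -mulrA -bilateral_exprz; apply: ler_wpM2l; first exact: ltW.
by apply: bilateral_homo => //; rewrite ltW.
Qed.

Lemma powR_sum_le_up_to_base xs ys :
  {in xs, forall x, 0 <= x} -> {in ys, forall x, 0 <= x} ->
  (forall s, 0 < s -> \sum_(x <- xs) h (s * x) <= \sum_(x <- ys) h (s * x)) ->
  \sum_(x <- xs) x `^ p <= Q ^+ 2 * \sum_(x <- ys) x `^ p.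
Proof.
move=> xs0 ys0 hle; have g0 := bilateral1_gt0.
rewrite -(ler_pM2l g0) mulr_sumr.
have bil : \sum_(x <- xs) bilateral x <= \sum_(x <- ys) bilateral x.
  rewrite !big_split -!mulr_sumr /=; apply: lerD.
    exact: (scale_sum_le Qi0 q0 up hCa).
  apply: ler_wpM2l; first exact: ltW.
  rewrite -!(big_map (fun x => q^-1 * x) xpredT).
  apply: (scale_sum_le Q0 qi0 down hCb).
  - by move=> _ /mapP[x /xs0 x0 ->]; rewrite mulr_ge0 // ltW.
  - by move=> _ /mapP[x /ys0 x0 ->]; rewrite mulr_ge0 // ltW.
  move=> s s0; rewrite !big_map; under eq_bigr do rewrite mulrA.
  under [leRHS]eq_bigr do rewrite mulrA.
  by apply: hle; rewrite mulr_gt0.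
apply: (@le_trans _ _ (Q * \sum_(x <- xs) bilateral x)).
  rewrite mulr_sumr big_seq [leRHS]big_seq; apply: ler_sum => x /xs0 x0.
  by have [_] := bilateral_powR x0.
apply: (@le_trans _ _ (Q * \sum_(x <- ys) bilateral x)).
  by apply: ler_wpM2l => //; exact: ltW.
rewrite expr2 -mulrA mulrCA; apply: ler_wpM2l; first exact: ltW.
rewrite mulrCA mulrA mulr_sumr big_seq [leRHS]big_seq.
apply: ler_sum => x /ys0 x0.
by have [+ _] := bilateral_powR x0; rewrite [Q * _]mulrC.
Qed.
End Base.

(** The growth bounds with exponents [a < p < b] make the bilateral series
    converge at both ends. *)
Lemma powR_sum_le_of_scaling xs ys :
  {in xs, forall x, 0 <= x} -> {in ys, forall x, 0 <= x} ->
  (forall s, 0 < s -> \sum_(x <- xs) h (s * x) <= \sum_(x <- ys) h (s * x)) ->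
  \sum_(x <- xs) x `^ p <= \sum_(x <- ys) x `^ p.
Proof.
move=> xs0 ys0 hle; apply/ler_addgt0Pr => e e0.
set B := \sum_(x <- ys) _.
have B0 : 0 <= B by apply: sumr_ge0 => x _; exact: powR_ge0.
(* With [q `^ p = 1 + d] and [d <= 1], the loss [(1 + d)^2 - 1] is at most
   [3 d], and [3 d B <= e]. *)
pose d := e / (3 * B + e).
have D0 : 0 < 3 * B + e by rewrite ltr_wpDl // mulr_ge0.
have d0 : 0 < d by rewrite divr_gt0.
have d1 : d <= 1 by rewrite ler_pdivrMr // mul1r lerDr mulr_ge0.
have Bd : 3 * B * d <= e.
  by rewrite mulrA ler_pdivrMr // mulrC ler_pM2l // lerDl ltW.
pose q := (1 + d) `^ p^-1.
have qp : q `^ p = 1 + d.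
  by rewrite -powRrM mulVf ?gt_eqF // powRr1 // ltW // addr_gt0.
have q1 : 1 < q.
  rewrite /q /powR gt_eqF ?addr_gt0 // expR_gt1 mulr_gt0 ?invr_gt0 // ln_gt0 //.
  by rewrite ltrDl.
apply: le_trans (powR_sum_le_up_to_base q1 xs0 ys0 hle) _; rewrite qp -/B.
have -> : (1 + d) ^+ 2 * B = B + (2 + d) * (B * d) by ring.
rewrite lerD2l; apply: le_trans Bd; rewrite -mulrA; apply: ler_wpM2r; last lra.
by rewrite mulr_ge0 // ltW.
Qed.
End TwoSided.
End Kernel.

(** Logarithmic growth is below any power; for small [x] the linear bound
    [ln (1 + x) <= x] takes over, which is why [a <= 1]. *)
Lemma log1D_le_powR a x : 0 < a -> a <= 1 -> 0 <= x ->
  ln (1 + x) <= (1 + a^-1) * x `^ a.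
Proof.
move=> a0 a1; rewrite le_eqVlt => /predU1P[<-|x0].
  by rewrite addr0 ln1 mulr_ge0 ?powR_ge0 // addr_ge0 // invr_ge0 ltW.
have ia0 : 0 <= a^-1 by rewrite invr_ge0 ltW.
have [x1|x1] := leP x 1.
  apply: le_trans (le_ln1Dx _) _; first lra.
  apply: (@le_trans _ _ (x `^ a)); first by rewrite ger1_powR // x0.
  by rewrite mulrDl mul1r lerDl mulr_ge0 ?powR_ge0.
have y0 : 0 < x `^ a by rewrite powR_gt0.
apply: (@le_trans _ _ (ln (1 + 1) + ln x)).
  rewrite -lnM ?posrE // ler_ln ?posrE; lra.
rewrite mulrDl mul1r; apply: lerD.
  apply: le_trans (le_ln1Dx _) _; first lra.
  by rewrite -(powRr0 x); apply: ler_powR; exact: ltW.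
rewrite ler_pdivlMl // -ln_powR; exact: ltW (ln_sublinear y0).
Qed.

Lemma subr_log1D_le x y : 0 <= x -> x <= y ->
  x - ln (1 + x) <= y - ln (1 + y).
Proof.
move=> x0 xy; have x1 : 0 < 1 + x by lra.
suff : ln (1 + y) - ln (1 + x) <= y - x by lra.
rewrite -ln_div ?posrE //; last lra.
have -> : (1 + y) / (1 + x) = 1 + (y - x) / (1 + x) by field; lra.
apply: le_trans (le_ln1Dx _) _.
  by apply: (@lt_le_trans _ _ 0) => //; rewrite divr_ge0; lra.
rewrite ler_pdivrMr //; nra.
Qed.

Lemma subr_log1D_le_sqr x : 0 <= x -> x - ln (1 + x) <= x ^+ 2.
Proof.
move=> x0; have x1 : 0 < 1 + x by lra.
have : - ln (1 + x) <= - (x / (1 + x)).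
  rewrite -lnV ?posrE //.
  have e : (1 + x)^-1 = 1 - x / (1 + x) by field; lra.
  rewrite [X in ln X]e.
  by apply: le_ln1Dx; rewrite ltrN2 ltr_pdivrMr //; lra.
suff : x - x / (1 + x) <= x ^+ 2 by lra.
have -> : x - x / (1 + x) = x ^+ 2 / (1 + x) by field; lra.
rewrite ler_pdivrMr // ler_peMr ?sqr_ge0 //; lra.
Qed.

Lemma sum_le_lim xs ys (T : topologicalType) (F : set_system T)
    {FF : ProperFilter F} (f : T -> R -> R) (g : R -> R) :
  {in xs, forall x, 0 <= x} -> {in ys, forall x, 0 <= x} ->
  (forall x, 0 <= x -> f t x @[t --> F] --> g x) ->
  (\forall t \near F, \sum_(x <- xs) f t x <= \sum_(x <- ys) f t x) ->
  \sum_(x <- xs) g x <= \sum_(x <- ys) g x.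
Proof.
move=> xs0 ys0 fg fle; apply: ler_cvg_to fle.
  by apply: (@cvg_sum_seq R R^o R _ F _ f g) => x /xs0; exact: fg.
by apply: (@cvg_sum_seq R R^o R _ F _ f g) => x /ys0; exact: fg.
Qed.

(** At [x = 0] the power is discontinuous in the exponent at [0], hence the
    first hypothesis. *)
Lemma cvg_powR_exponent x p0 : 0 < x \/ 0 < p0 -> 0 <= x ->
  x `^ p @[p --> p0] --> x `^ p0.
Proof.
move=> xp; rewrite le_eqVlt => /predU1P[x0|x0].
  case: xp; first by rewrite -x0 ltxx.
  move=> p00; rewrite -x0 powR0 ?gt_eqF //.
  apply: cvg_near_cst; near=> p; rewrite powR0 // gt_eqF //; near: p.
  exact: lt_nbhsr.
rewrite /powR gt_eqF //.
apply: (@cvg_comp _ _ _ (fun p => p * ln x) expR); last exact: continuous_expR.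
by apply: cvgM; [exact: cvg_id|exact: cvg_cst].
Unshelve. all: by end_near. Qed.

(** From here on [xs] and [ys] are only known through what linear algebra
    provides: the sums of logarithms [ln (1 + s x)] and the plain sums. *)
Section LogDomination.
Variables xs ys : seq R.
Hypotheses (xs0 : {in xs, forall x, 0 <= x}) (ys0 : {in ys, forall x, 0 <= x}).
Hypothesis log_le : forall s, 0 <= s ->
  \sum_(x <- xs) ln (1 + s * x) <= \sum_(x <- ys) ln (1 + s * x).
Hypothesis sum_eq : \sum_(x <- xs) x = \sum_(x <- ys) x.

Lemma powR_sum_le01 p : 0 < p -> p < 1 ->
  \sum_(x <- xs) x `^ p <= \sum_(x <- ys) x `^ p.
Proof.
move=> p0 p1.
apply: (@powR_sum_le_of_scaling (fun x => ln (1 + x)) _ _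
          p (p / 2) 1 (1 + (p / 2)^-1) 1) => //.
- by move=> x x0; rewrite ln_ge0 // lerDl.
- by move=> x y x0 xy; rewrite ler_ln ?posrE; lra.
- lra.
- by rewrite ln_gt0 //; lra.
- by move=> x; apply: log1D_le_powR; lra.
- by move=> x x0; rewrite powRr1 // mul1r le_ln1Dx //; lra.
- by move=> s s0; apply: log_le; rewrite ltW.
Qed.

Lemma powR_sum_le12 p : 1 < p -> p < 2 ->
  \sum_(x <- ys) x `^ p <= \sum_(x <- xs) x `^ p.
Proof.
move=> p1 p2.
apply: (@powR_sum_le_of_scaling (fun x => x - ln (1 + x)) _ _ p 1 2 1 1) => //.
- by move=> x x0; rewrite subr_ge0 le_ln1Dx //; lra.
- exact: subr_log1D_le.
- exact: lt_trans p1.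
- rewrite subr_gt0 -ltr_expR lnK ?posrE; last lra.
  by apply: expR_gt1Dx; rewrite oner_eq0.
- by move=> x x0; rewrite powRr1 // mul1r gerBl ln_ge0 // lerDl.
- by move=> x x0; rewrite powR_mulrn // mul1r subr_log1D_le_sqr.
- move=> s s0; rewrite !sumrB -!mulr_sumr sum_eq lerD2l lerN2.
  by apply: log_le; exact: ltW.
Qed.

Lemma cvg_powR_support x : 0 <= x ->
  x `^ p @[p --> (0 : R)^'+] --> ((x != 0)%:R : R).
Proof.
rewrite le_eqVlt => /predU1P[<-|x0].
  rewrite eqxx; apply: cvg_near_cst; near=> p; rewrite powR0 //.
rewrite gt_eqF //= -[X in _ --> X](powRr0 x); apply: cvg_at_right_filter.
by apply: cvg_powR_exponent; rewrite ?(ltW x0) //; left.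
Unshelve. all: by end_near. Qed.

Lemma cvg_powR_xlogx x : 0 <= x ->
  (x `^ p - x) / (p - 1) @[p --> (1 : R)^'+] --> x * ln x.
Proof.
rewrite le_eqVlt => /predU1P[<-|x0].
  rewrite mul0r; apply: cvg_near_cst; near=> p.
  have p1 : 1 < p by near: p; exact: nbhs_right_gt.
  by rewrite powR0 ?subrr ?mul0r // gt_eqF // (lt_trans _ p1).
(* With [u := (p - 1) ln x], the bounds [u <= exp u - 1 <= u exp u]. *)
apply: (@squeeze_cvgr _ _ _ _ (fun=> x * ln x) (fun p => x `^ p * ln x)).
- near=> p; have p1 : 0 < p - 1.
    by rewrite subr_gt0; near: p; exact: nbhs_right_gt.
  have xp : x `^ p = x * expR ((p - 1) * ln x).
    by rewrite /powR gt_eqF // -{2}[x]lnK ?posrE // -expRD; congr expR; ring.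
  rewrite ler_pdivlMr // ler_pdivrMr // xp; apply/andP; split.
    have := expR_ge1Dx ((p - 1) * ln x); nra.
  have := expR_ge1Dx (- ((p - 1) * ln x)).
  rewrite expRN -(ler_pM2l (expR_gt0 ((p - 1) * ln x))) mulfV ?gt_eqF
    ?expR_gt0 //.
  nra.
- exact: cvg_cst.
- apply: cvgM; last exact: cvg_cst.
  rewrite -[X in _ --> X](powRr1 (ltW x0)); apply: cvg_at_right_filter.
  by apply: cvg_powR_exponent; rewrite ?(ltW x0) //; left.
Unshelve. all: by end_near. Qed.

Lemma support_sum_le :
  \sum_(x <- xs) (x != 0)%:R <= \sum_(x <- ys) (x != 0)%:R :> R.
Proof.
apply: (@sum_le_lim _ _ _ (0 : R)^'+ _ (fun p x => x `^ p)) => //.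
  exact: cvg_powR_support.
near=> p; apply: powR_sum_le01; near: p.
  exact: nbhs_right_gt.
exact: nbhs_right_lt.
Unshelve. all: by end_near. Qed.

Lemma sqr_sum_le : \sum_(x <- ys) x `^ 2 <= \sum_(x <- xs) x `^ 2.
Proof.
apply: (@sum_le_lim _ _ _ (2 : R)^'- _ (fun p x => x `^ p)) => //.
  move=> x x0; apply: cvg_at_left_filter; apply: cvg_powR_exponent => //.
  by right; exact: ltr0n.
near=> p; apply: powR_sum_le12; near: p; last exact: nbhs_left_lt.
by apply: nbhs_left_gt; rewrite ltr1n.
Unshelve. all: by end_near. Qed.

Lemma xlogx_sum_le : \sum_(x <- ys) x * ln x <= \sum_(x <- xs) x * ln x.
Proof.
apply: (@sum_le_lim _ _ _ (1 : R)^'+ _ 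
    (fun p x => (x `^ p - x) / (p - 1))) => //.
  exact: cvg_powR_xlogx.
near=> p; have p1 : 1 < p by near: p; exact: nbhs_right_gt.
rewrite -!mulr_suml; apply: ler_wpM2r; first by rewrite invr_ge0 subr_ge0 ltW.
rewrite !sumrB sum_eq lerD2r; apply: powR_sum_le12 => //; near: p.
by apply: nbhs_right_lt; rewrite ltr1n.
Unshelve. all: by end_near. Qed.
End LogDomination.
End Scale.

(** * Log-submodularity of principal minors *)

(** Sylvester's identity: both sides are the determinant of
    [block_mx 1 (- X) Y 1], which can be triangularised by eliminating either
    diagonal block. *)
Lemma det_1D_mulmxC (C : comUnitRingType) (m n : nat)
    (X : 'M[C]_(m, n)) (Y : 'M[C]_(n, m)) :
  \det (1%:M + X *m Y) = \det (1%:M + Y *m X).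
Proof.
pose B := block_mx 1%:M (- X) Y 1%:M.
have BL : B = block_mx 1%:M 0 Y 1%:M *m block_mx 1%:M (- X) 0 (1%:M + Y *m X).
  rewrite mulmx_block ?(mul1mx, mul0mx, mulmx1, mulmx0, mulmxN, addr0).
  by rewrite addrCA addNr addr0.
have BR : B = block_mx 1%:M (- X) 0 1%:M *m block_mx (1%:M + X *m Y) 0 Y 1%:M.
  rewrite mulmx_block ?(mul1mx, mul0mx, mulmx1, mulmx0, mulNmx, addr0, add0r).
  by rewrite addrK.
have := congr1 determinant BL; rewrite {1}BR !det_mulmx.
by rewrite !det_lblock !det_ublock !det1 !mul1r !mulr1.
Qed.

Section Submodular.
Variables (R : realDomainType) (T : finType) (f : {set T} -> R).

(** Build [I] from [I :&: J] by adding the elements of [I :\: J] one at a time: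
    each raises [f] at least as much on top of a part of [I] as on top of that
    part joined to [J]. *)
Lemma submodular_of_diminishing_returns :
  (forall (K L : {set T}) i, K \subset L -> i \notin L ->
     f (i |: L) + f K <= f (i |: K) + f L) ->
  forall I J : {set T}, f (I :|: J) + f (I :&: J) <= f I + f J.
Proof.
move=> fP I J; have [n] := ubnP #|I :\: J|; elim: n I => // n IHn I.
have [ | [i iIJ] ] := set_0Vmem (I :\: J).
  move=> /eqP; rewrite finset.setD_eq0 => IJ _.
  by rewrite (finset.setIidPl IJ) (finset.setUidPr IJ) addrC.
move: iIJ; rewrite inE => /andP[iJ iI]; rewrite ltnS => ltn.
have Ii : i |: I :\ i = I by rewrite finset.setD1K.
have IJi : (I :\ i) :&: J = I :&: J.
  apply/setP=> k; rewrite !inE; case: eqVneq => // ->.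
  by rewrite (negbTE iJ) !andbF.
have := IHn (I :\ i); rewrite IJi => /(_ _).
have -> : (#|(I :\ i) :\: J| < n)%N.
  apply: leq_trans ltn; apply: proper_card; apply/properP; split.
    by apply/fintype.subsetP => k; rewrite !inE => /andP[-> /andP[_ ->]].
  by exists i; rewrite !inE ?eqxx ?iJ ?iI.
move=> /(_ isT) h1.
have := fP (I :\ i) ((I :\ i) :|: J) i.
rewrite finset.subsetUl !inE eqxx (negbTE iJ) => /(_ isT isT).
rewrite finset.setUA Ii; lra.
Qed.
End Submodular.

Section Minors.
Variable R : realType.
Local Notation C := R[i].
Local Open Scope complex_scope.
Local Open Scope sesquilinear_scope.

Definition mask_mx (m : nat) (K : {set 'I_m}) : 'M[C]_m :=
  diag_mx (\row_i (i \in K)%:R).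

Lemma mask_mx_idem m (K : {set 'I_m}) : mask_mx K *m mask_mx K = mask_mx K.
Proof.
rewrite /mask_mx mulmx_diag; congr diag_mx; apply/rowP => i; rewrite !mxE.
by case: (i \in K); rewrite ?mulr1 ?mulr0.
Qed.

Lemma mask_mx_adj m (K : {set 'I_m}) : (mask_mx K)^t* = mask_mx K.
Proof.
apply/matrixP => i j; rewrite !mxE eq_sym; case: eqVneq => [->|_].
  by rewrite !mulr1n rmorph_nat.
by rewrite !mulr0n rmorph0.
Qed.

Lemma adjmxM m n p (X : 'M[C]_(m, n)) (Y : 'M[C]_(n, p)) :
  (X *m Y)^t* = Y^t* *m X^t*.
Proof. by rewrite trmx_mul map_mxM. Qed.

Lemma adjmxD m n (X Y : 'M[C]_(m, n)) : (X + Y)^t* = X^t* + Y^t*.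
Proof. by rewrite raddfD /= map_mxD. Qed.

Lemma hermsymmx_adj m (A : 'M[C]_m) : (A \is hermsymmx) = (A^t* == A).
Proof. by rewrite qualifE /= expr0 scale1r eq_sym. Qed.

Lemma normsq_mx_ge0 m (x : 'cV[C]_m) : 0 <= (x^t* *m x) 0 0.
Proof.
rewrite mxE sumr_ge0 // => i _; rewrite !mxE mulrC.
by rewrite -normCK exprn_ge0.
Qed.

Lemma normsq_mx_eq0 m (x : 'cV[C]_m) : (x^t* *m x) 0 0 = 0 -> x = 0.
Proof.
rewrite mxE => /eqP; rewrite psumr_eq0 => [/allP h|i _]; last first.
  by rewrite !mxE mulrC -normCK exprn_ge0.
apply/colP => i; have := h i (mem_index_enum _).
by rewrite !mxE mulrC -normCK expf_eq0 /= normr_eq0 => /eqP.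
Qed.

Lemma diag_quadratic_form m (A : 'M[C]_m) i :
  A i i = ((delta_mx i 0 : 'cV[C]_m)^t* *m A *m (delta_mx i 0 : 'cV[C]_m)) 0 0.
Proof. by rewrite trmx_delta map_delta_mx -mulmxA -rowE -colE !mxE. Qed.

(** This is the determinant of [1 + A[K]] ([det_principal_submx]), written with
    a matrix whose size does not depend on [K]. *)
Definition det1D_minor m (A : 'M[C]_m) (K : {set 'I_m}) : C :=
  \det (1%:M + A *m mask_mx K).

(** [S] is [(1 + A D)^-1 A], which takes over the role of [A] once the indices
    in [K] have been taken into account ([det1D_minor_swept]). The equation
    [S + A D S = A] avoids the inverse in computations. *)
Section Swept.
Variables (m : nat) (A S : 'M[C]_m) (K : {set 'I_m}).
Let D := mask_mx K.
Hypotheses (hA : nonneg_definite A) (sweptE : S + A *m D *m S = A).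

(** A row [v] killed by [1 + A D] satisfies [v = - v A D], hence [v D = v] and
    [v v^* = - v A v^*], which forces [v = 0]. *)
Lemma unitmx_1D_mask : 1%:M + A *m D \in unitmx.
Proof.
rewrite unitmxE unitfE; apply/negP => /det0P[v v0].
have [x vx] : exists x, v = x^t* by exists (v^t*); rewrite trmxCK.
rewrite {v}vx in v0 *.
rewrite mulmxDr mulmx1 => /eqP; rewrite addr_eq0 => /eqP xE.
have xD : x^t* *m D = x^t* by rewrite {1}xE mulNmx -!mulmxA mask_mx_idem -xE.
have Dx : D *m x = x.
  by rewrite -[RHS]trmxCK -[in RHS]xD adjmxM mask_mx_adj trmxCK.
have e : (x^t* *m x) 0 0 = - (x^t* *m A *m x) 0 0.
  by rewrite {1}xE mulNmx !mulmxA -(mulmxA _ D) Dx mxE.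
have x_le0 : (x^t* *m x) 0 0 <= 0 by rewrite e oppr_le0; case: hA.
have x0 : x = 0.
  by apply: normsq_mx_eq0; apply/eqP; rewrite eq_le x_le0 normsq_mx_ge0.
by rewrite x0 trmx0 map_mx0 eqxx in v0.
Qed.

Lemma adjmx_psd : A^t* = A.
Proof. by case: hA; rewrite hermsymmx_adj => /eqP. Qed.

(** [S] and its adjoint solve the same equation: [S^* (1 + D A) = A], and
    [(1 + A D) A = A (1 + D A)]. *)
Lemma swept_adj : S^t* = S.
Proof.
have U := unitmx_1D_mask.
have U' : 1%:M + D *m A \in unitmx by rewrite unitmxE -det_1D_mulmxC -unitmxE.
have e : S^t* *m (1%:M + D *m A) = A.
  rewrite -[RHS]adjmx_psd -[in RHS]sweptE -[in RHS]mulmxA.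
  by rewrite adjmxD !adjmxM mask_mx_adj adjmx_psd mulmxDr mulmx1 mulmxA.
apply: (can_inj (mulKmx U)); rewrite [RHS]mulmxDl mul1mx sweptE.
apply: (can_inj (mulmxK U')); rewrite -mulmxA e.
by rewrite mulmxDl mulmxDr mul1mx mulmx1 mulmxA.
Qed.

(** With [z := S x] and [y := x - D z] one has [z = A y], so that
    [x^* S x = y^* A y + (D z)^* (D z)]. *)
Lemma swept_psd : nonneg_definite S.
Proof.
split=> [|x]; first by rewrite hermsymmx_adj swept_adj.
pose z := S *m x; pose y := x - D *m z.
have zE : z = A *m y.
  have e : A *m x = z + A *m D *m z.
    by rewrite /z [A *m D *m (S *m x)]mulmxA -mulmxDl sweptE.
  by rewrite mulmxBr e [A *m (D *m z)]mulmxA addrK.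
have -> : x^t* *m S *m x = y^t* *m A *m y + (D *m z)^t* *m (D *m z).
  have xE : x = y + D *m z by rewrite subrK.
  rewrite -mulmxA -/z {1}xE adjmxD mulmxDl -(mulmxA _ A) -zE; congr (_ + _).
  by rewrite adjmxM mask_mx_adj -!mulmxA (mulmxA D D) mask_mx_idem.
by rewrite mxE addr_ge0 ?normsq_mx_ge0 //; case: hA.
Qed.

(** [A - S = A D S = S D S + S D A D S] is a sum of two nonnegative definite
    matrices. *)
Lemma swept_diag_le i : S i i <= A i i.
Proof.
have adjE : A = S + S *m D *m A.
  rewrite -[LHS]adjmx_psd -[in LHS]sweptE adjmxD !adjmxM mask_mx_adj.
  by rewrite adjmx_psd swept_adj mulmxA.
pose w := D *m S *m (delta_mx i 0 : 'cV_m).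
have wE : w^t* = (delta_mx i 0 : 'cV[C]_m)^t* *m S *m D.
  by rewrite !adjmxM mask_mx_adj swept_adj mulmxA.
have diffE : A *m D *m S = S *m D *m (D *m S) + S *m D *m A *m (D *m S).
  rewrite -mulmxA {1}adjE mulmxDl; congr (_ + _).
  by rewrite -[RHS]mulmxA (mulmxA D D S) mask_mx_idem.
have -> : A i i = S i i + (A *m D *m S) i i.
  by have := congr1 (fun M => fun_of_matrix M i i) sweptE; rewrite /= [LHS]mxE.
rewrite lerDl [leRHS]diag_quadratic_form.
have -> : (delta_mx i 0 : 'cV[C]_m)^t* *m (A *m D *m S) *m delta_mx i 0 =
    w^t* *m w + w^t* *m A *m w.
  by rewrite wE diffE mulmxDr mulmxDl !mulmxA.
by rewrite mxE addr_ge0 ?normsq_mx_ge0 //; case: hA.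
Qed.

(** [1 + A (D_K + D_L) = (1 + A D_K) (1 + S D_L)]. *)
Lemma det1D_minor_swept (L : {set 'I_m}) : [disjoint K & L] ->
  det1D_minor A (K :|: L) = det1D_minor A K * det1D_minor S L.
Proof.
move=> dKL; rewrite /det1D_minor -/D -det_mulmx mulmxDr mulmx1 mulmxA.
rewrite [(1%:M + A *m D) *m S]mulmxDl mul1mx sweptE -addrA -mulmxDr.
congr (\det (_ + _ *m _)).
apply/matrixP => i j; rewrite !mxE -mulrnDl; congr (_ *+ _).
rewrite finset.in_setU; case iK: (i \in K); case iL: (i \in L).
- by move: dKL => /pred0P /(_ i) /=; rewrite iK iL.
- by rewrite addr0.
- by rewrite add0r.
- by rewrite addr0.
Qed.
End Swept.

Lemma swept_exists m (A : 'M[C]_m) (K : {set 'I_m}) : nonneg_definite A ->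
  exists S : 'M[C]_m, S + A *m mask_mx K *m S = A.
Proof.
move=> hA; exists (invmx (1%:M + A *m mask_mx K) *m A).
by rewrite -[X in X + _]mul1mx -mulmxDl mulKVmx // unitmx_1D_mask.
Qed.

Lemma det1D_minor1 m (A : 'M[C]_m) i : det1D_minor A [set i] = 1 + A i i.
Proof.
rewrite /det1D_minor.
have -> : mask_mx [set i] = delta_mx i (0 : 'I_1) *m delta_mx 0 i.
  rewrite mul_delta_mx; apply/matrixP => k l; rewrite !mxE inE.
  have [->|ki] := eqVneq k i; last by rewrite mul0rn.
  by rewrite mulr1n /= eq_sym; case: (l == i).
rewrite mulmxA det_1D_mulmxC -colE -rowE det_mx11 !mxE eqxx.
by [].
Qed.

(** After dividing by the minors of [K] and [L], the inequality reads
    [1 + S' i i <= 1 + S i i], where [S] sweeps [K] out of [A] and [S'] sweeps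
    [L :\: K] out of [S]. *)
Lemma diminishing_minors m (A : 'M[C]_m) (K L : {set 'I_m}) i :
    nonneg_definite A ->
    (forall K, 0 <= det1D_minor A K) -> K \subset L -> i \notin L ->
  det1D_minor A (i |: L) * det1D_minor A K <=
  det1D_minor A (i |: K) * det1D_minor A L.
Proof.
move=> hA d0 KL iL; have iK : i \notin K.
  by apply: contra iL; apply: (fintype.subsetP KL).
have [S SE] := swept_exists K hA; have hS := swept_psd hA SE.
have [S' S'E] := swept_exists (L :\: K) hS.
pose X := L :\: K; have iX : i \notin X by rewrite inE (negbTE iL) andbF.
have LE : L = K :|: X.
  apply/setP => k; rewrite !inE; case kK: (k \in K) => //=.
  exact: (fintype.subsetP KL).
have KX : [disjoint K & X].
  by apply/pred0P => k; rewrite /= !inE; case: (k \in K).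
have Ki : [disjoint K & [set i]].
  apply/pred0P => k; rewrite /= !inE.
  by case: eqVneq => [->|]; rewrite ?(negbTE iK) ?andbF.
have Xi : [disjoint X & [set i]].
  apply/pred0P => k; rewrite /= !inE.
  by case: eqVneq => [->|]; rewrite ?(negbTE iL) ?andbF.
have KXi : [disjoint K & X :|: [set i]].
  apply/pred0P => k; rewrite /= !inE; case kK: (k \in K) => //=.
  by case: eqVneq kK => [->|//]; rewrite (negbTE iK).
have -> : i |: L = K :|: (X :|: [set i]).
  by rewrite LE finset.setUC finset.setUA.
rewrite (finset.setUC [set i] K).
rewrite (det1D_minor_swept SE KXi) (det1D_minor_swept SE Ki).
have L0 := d0 L; have K0 := d0 K; rewrite LE in L0 *.
rewrite (det1D_minor_swept SE KX) in L0 *.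
rewrite (det1D_minor_swept S'E Xi) !det1D_minor1.
have -> (x y z : C) : x * (y * z) * x = x * (x * y) * z by ring.
have -> (x y z : C) : x * z * (x * y) = x * (x * y) * z by ring.
apply: ler_wpM2l; first exact: mulr_ge0.
by rewrite lerD2l; exact: swept_diag_le hS S'E _.
Qed.

(** * Spectra of principal submatrices *)

Lemma spectral_diag_ge0 n (A : 'M[C]_n) i :
  nonneg_definite A -> 0 <= spectral_diag A 0 i.
Proof.
case=> hA pA; set P := spectralmx A.
have U : P \in unitmx := spectral_unit A.
have /orthomx_spectralP e := hermitian_normalmx hA.
have -> : spectral_diag A 0 i = (P *m A *m invmx P) i i.
  by rewrite {2}e !mulmxA mulmxV // mul1mx mulmxK // mxE eqxx mulr1n.
rewrite diag_quadratic_form -!mulmxA invmx_unitary ?spectral_unitarymx //.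
rewrite mulmxA.
have -> : (delta_mx i 0 : 'cV[C]_n)^t* *m P = (P^t* *m delta_mx i 0)^t*.
  by rewrite adjmxM trmxCK.
by rewrite mulmxA.
Qed.

Lemma spectral_diagE n (A : 'M[C]_n) i : nonneg_definite A ->
  spectral_diag A 0 i = (complex.Re (spectral_diag A 0 i))%:C.
Proof.
move=> /(spectral_diag_ge0 i) /ger0_Im.
by case: (spectral_diag _ _ _) => a b /= ->.
Qed.

Lemma det_spectral n (A : 'M[C]_n) (s : R) : nonneg_definite A ->
  \det (1%:M + s%:C *: A) =
  (\prod_i (1 + s * complex.Re (spectral_diag A 0 i)))%:C.
Proof.
move=> hA; have U := spectral_unit A.
have /orthomx_spectralP e := hermitian_normalmx (proj1 hA).
have -> : 1%:M + s%:C *: A = invmx (spectralmx A) *m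
    (1%:M + s%:C *: diag_mx (spectral_diag A)) *m spectralmx A.
  rewrite mulmxDr mulmxDl mulmx1 mulVmx // -scalemxAr -scalemxAl.
  by congr (_ + _ *: _); exact: e.
rewrite !det_mulmx mulrAC -det_mulmx mulVmx // det1 mul1r.
have -> : 1%:M + s%:C *: diag_mx (spectral_diag A) =
   diag_mx (\row_i (1 + s * complex.Re (spectral_diag A 0 i))%:C).
  apply/matrixP => k l; rewrite !mxE; case: eqVneq => [->|_]; last first.
    by rewrite !mulr0n mulr0 addr0.
  by rewrite !mulr1n rmorphD rmorphM rmorph1 /= [in LHS]spectral_diagE.
by rewrite det_diag rmorph_prod; apply: eq_bigr => i _; rewrite mxE.
Qed.

Section Principal.
Variables (m : nat) (A : 'M[C]_m).

Definition selection_mx (K : {set 'I_m}) : 'M[C]_(#|K|, m) :=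
  rowsub (fun i : 'I_#|K| => enum_val i) 1%:M.

Lemma selection_mx_adj K : (selection_mx K)^t* = (selection_mx K)^T.
Proof. by apply/matrixP=> i j; rewrite !mxE rmorph_nat. Qed.

Lemma selection_mx_proj K : (selection_mx K)^T *m selection_mx K = mask_mx K.
Proof.
apply/matrixP => i j; rewrite !mxE.
have [iK|iK] := boolP (i \in K); last first.
  rewrite mul0rn big1 // => k _; rewrite !mxE.
  by case: eqVneq (enum_valP k) iK => [->->|]; rewrite ?mul0r.
rewrite (bigD1 (enum_rank_in iK i)) //= big1 ?addr0 => [|k ki].
  by rewrite !mxE enum_rankK_in // eqxx mul1r.
have /negbTE ki' : enum_val k != i.
  by apply: contra ki => /eqP e; apply/eqP/enum_val_inj; rewrite enum_rankK_in.
by rewrite !mxE ki' mul0r.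
Qed.

(** This expression turns statements on [A[K]] into statements on
    [A *m mask_mx K], through [det_1D_mulmxC] and [selection_mx_proj]. *)
Lemma principal_submxE K :
  principal_submx A K = selection_mx K *m A *m (selection_mx K)^T.
Proof.
have -> : (selection_mx K)^T = colsub (fun i : 'I_#|K| => enum_val i) 1%:M.
  by apply/matrixP => i j; rewrite !mxE eq_sym.
rewrite mul_rowsub_mx mul1mx mulmx_colsub mulmx1.
by apply/matrixP => i j; rewrite !mxE.
Qed.

Lemma principal_submx_psd K :
  nonneg_definite A -> nonneg_definite (principal_submx A K).
Proof.
case=> hA pA; rewrite principal_submxE; split.
  move: hA; rewrite !hermsymmx_adj => /eqP hA; apply/eqP.
  rewrite -[in LHS]selection_mx_adj !adjmxM trmxCK hA.
  by rewrite selection_mx_adj mulmxA.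
move=> x; have := pA ((selection_mx K)^T *m x).
rewrite -[in X in X -> _]selection_mx_adj adjmxM trmxCK.
by rewrite selection_mx_adj !mulmxA.
Qed.

Lemma det_principal_submx K (s : R) :
  \det (1%:M + s%:C *: principal_submx A K) = det1D_minor (s%:C *: A) K.
Proof.
rewrite /det1D_minor principal_submxE -selection_mx_proj mulmxA det_1D_mulmxC.
by rewrite -scalemxAl -scalemxAr mulmxA.
Qed.

Lemma mxtrace_principal_submx K :
  \tr (principal_submx A K) = \sum_(i in K) A i i.
Proof.
rewrite big_enum_val.
by apply: eq_bigr => i _; rewrite mxE.
Qed.

Lemma mxtrace_spectral n (B : 'M[C]_n) : nonneg_definite B ->
  \tr B = (\sum_i complex.Re (spectral_diag B 0 i))%:C.
Proof.
move=> hB; have /orthomx_spectralP {1}-> := hermitian_normalmx (proj1 hB).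
rewrite -mulmxA mxtrace_mulC mulmxK ?spectral_unit // mxtrace_diag rmorph_sum.
by apply: eq_bigr => i _; exact: spectral_diagE.
Qed.
End Principal.

Definition spectrum n (A : 'M[C]_n) : seq R :=
  [seq complex.Re (spectral_diag A 0 i) | i <- enum 'I_n].

Lemma big_spectrum n (A : 'M[C]_n) (f : R -> R) :
  \sum_(x <- spectrum A) f x = \sum_i f (complex.Re (spectral_diag A 0 i)).
Proof. by rewrite big_map big_enum. Qed.

Lemma spectrum_ge0 n (A : 'M[C]_n) :
  nonneg_definite A -> {in spectrum A, forall x, 0 <= x}.
Proof.
move=> hA _ /mapP[i _ ->]; have := spectral_diag_ge0 i hA.
by rewrite spectral_diagE // lecR.
Qed.

Lemma nonneg_definiteZ n (A : 'M[C]_n) (s : R) : 0 <= s ->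
  nonneg_definite A -> nonneg_definite (s%:C *: A).
Proof.
move=> s0 [hA pA]; split=> [|x].
  move: hA; rewrite !hermsymmx_adj => /eqP hA; apply/eqP.
  rewrite linearZ map_mxZ /= hA; congr (_ *: _).
  by apply/CrealP; rewrite complex_real.
by rewrite -scalemxAr -scalemxAl mxE mulr_ge0 // lecR.
Qed.

Lemma ln_prod (T : Type) (r : seq T) (F : T -> R) : (forall i, 0 < F i) ->
  ln (\prod_(i <- r) F i) = \sum_(i <- r) ln (F i).
Proof.
move=> F0; elim: r => [|i r IH]; first by rewrite !big_nil ln1.
by rewrite !big_cons lnM ?posrE ?prodr_gt0 // IH.
Qed.

Section LogDet.
Variables (m : nat) (A : 'M[C]_m).
Hypothesis hA : nonneg_definite A.

Lemma log_det_submodular (I J : {set 'I_m}) (s : R) : 0 <= s ->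
  \sum_(x <- spectrum (principal_submx A (I :|: J)) ++
             spectrum (principal_submx A (I :&: J))) ln (1 + s * x) <=
  \sum_(x <- spectrum (principal_submx A I) ++ spectrum (principal_submx A J))
     ln (1 + s * x).
Proof.
move=> s0; rewrite !big_cat /=.
pose lam K i := complex.Re (spectral_diag (principal_submx A K) 0 i).
pose g K := \prod_i (1 + s * lam K i).
have factor_gt0 K i : 0 < 1 + s * lam K i.
  have psd := principal_submx_psd K hA.
  by rewrite ltr_wpDr // mulr_ge0 // -lecR -spectral_diagE // spectral_diag_ge0.
have g_gt0 K : 0 < g K by apply: prodr_gt0.
have gE K : det1D_minor (s%:C *: A) K = (g K)%:C.
  by rewrite -det_principal_submx det_spectral //; exact: principal_submx_psd.
have lnE K :
    \sum_(x <- spectrum (principal_submx A K)) ln (1 + s * x) = ln (g K).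
  by rewrite big_spectrum -ln_prod // => i; exact: factor_gt0.
rewrite !lnE.
apply: (submodular_of_diminishing_returns (f := fun K => ln (g K))) => {I J}.
move=> K L i KL iL; rewrite -!lnM ?posrE // ler_ln ?posrE ?mulr_gt0 //.
have := diminishing_minors (nonneg_definiteZ s0 hA) _ KL iL.
rewrite !gE -!rmorphM lecR; apply=> M.
by rewrite gE lecR ltW.
Qed.

Lemma trace_modular (I J : {set 'I_m}) :
  \sum_(x <- spectrum (principal_submx A (I :|: J)) ++
             spectrum (principal_submx A (I :&: J))) x =
  \sum_(x <- spectrum (principal_submx A I) ++
             spectrum (principal_submx A J)) x.
Proof.
have trE K :
    (\sum_(x <- spectrum (principal_submx A K)) x)%:C = \sum_(i in K) A i i.
  rewrite big_spectrum -mxtrace_spectral ?mxtrace_principal_submx //.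
  exact: principal_submx_psd.
apply: complexI; rewrite !big_cat !rmorphD /= !trE.
rewrite [X in _ = X + _](big_setID J) [X in X + _ = _](big_setID J) /=.
have -> : (I :|: J) :&: J = J.
  by apply/setP => k; rewrite !inE; case: (k \in J); rewrite ?orbT ?andbF.
have -> : (I :|: J) :\: J = I :\: J.
  by apply/setP => k; rewrite !inE; case: (k \in J); rewrite ?orbF.
by rewrite addrAC [RHS]addrC addrA.
Qed.
End LogDet.
End Minors.

(** * Traces of functions of a matrix *)

Section SpectralLimits.
Variable R : realType.
Local Notation C := R[i].
Local Open Scope complex_scope.
Local Open Scope classical_set_scope.

Lemma cvg_real_complex (T : Type) (F : set_system T) {FF : Filter F}
    (f : T -> R) (l : R) :
  f t @[t --> F] --> l -> ((f t)%:C : C^o) @[t --> F] --> (l%:C : C^o).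
Proof.
move=> /cvgrPdist_lt fl; apply/cvgrPdist_lt => e e0.
have e_real : e = (complex.Re e)%:C.
  by have := ger0_Im (ltW e0); case: (e) => a b /= ->.
have {}e0 : 0 < complex.Re e by rewrite -ltcR -e_real.
near=> t; rewrite e_real -rmorphB normc_def /= expr0n /= addr0 sqrtr_sqr ltcR.
by near: t; exact: fl.
Unshelve. all: by end_near. Qed.

(** Each entry of [mxfun f A] is a linear combination of the values of [f] at
    the eigenvalues, with coefficients independent of [f]. *)
Lemma cvg_mxfun (T : Type) (F : set_system T) {FF : Filter F} n (A : 'M[C]_n)
    (f : T -> R -> R) (g : R -> R) :
  (forall i, f t (complex.Re (spectral_diag A 0 i)) @[t --> F] -->
             g (complex.Re (spectral_diag A 0 i))) ->
  mxfun (f t) A @[t --> F] --> mxfun g A.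
Proof.
move=> fg; apply/cvg_ballP => e e0.
have scale (c : C) (z : T -> C) (l : C) :
    (z t : C^o) @[t --> F] --> (l : C^o) ->
    (c * z t : C^o) @[t --> F] --> (c * l : C^o).
  by move=> zl; exact: (@cvgZl_tmp C C^o _ _ _ c _ l zl).
have entry i j : (mxfun (f t) A i j : C^o) @[t --> F] --> (mxfun g A i j : C^o).
  pose coef k := invmx (spectralmx A) i k * spectralmx A k j.
  pose lam k := complex.Re (spectral_diag A 0 k).
  have E h : mxfun h A i j = \sum_k coef k * (h (lam k))%:C.
    rewrite /mxfun -mulmxA mxE; apply: eq_bigr => k _.
    by rewrite /coef mul_diag_mx !mxE mulrA mulrAC.
  (* Stated for abstract [u] and [l], so that the entries of [mxfun] are not
     unfolded when the equations are used. *)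
  have cvg_of_eq (u : T -> C) (l : C) :
      (forall t, u t = \sum_k coef k * (f t (lam k))%:C) ->
      l = \sum_k coef k * (g (lam k))%:C ->
    (u t : C^o) @[t --> F] --> (l : C^o).
    move=> /funext -> ->; apply: (@cvg_sum_seq C C^o) => k _.
    by apply: scale; apply: cvg_real_complex; exact: fg.
  exact: cvg_of_eq (fun t => E (f t)) (E g).
near=> t; split => //; near: t.
apply: filter_forall => i; apply: filter_forall => j.
by have /cvg_ballP := entry i j; apply.
Unshelve. all: by end_near. Qed.

(** Limits of matrices are unique because their entries lie in the Hausdorff
    space [C]. *)
Lemma lim_mxfun (T : Type) (F : set_system T) {FF : ProperFilter F} n
    (A : 'M[C]_n) (f : T -> R -> R) (g : R -> R) :
  (forall i, f t (complex.Re (spectral_diag A 0 i)) @[t --> F] -->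
             g (complex.Re (spectral_diag A 0 i))) ->
  lim (mxfun (f t) A @[t --> F]) = mxfun g A.
Proof.
move=> /cvg_mxfun c; have c' := cvgP _ c.
have /= := cvg_close c' c; rewrite ball_close => cl.
apply/matrixP => i j; apply: (@close_eq (C^o)); first exact: norm_hausdorff.
by rewrite ball_close => e; have [_ /(_ i j)] := cl _ e.
Qed.
End SpectralLimits.

Section Traces.
Variable R : realType.
Local Notation C := R[i].
Local Open Scope complex_scope.

Lemma mxtrace_mxfun n (B : 'M[C]_n) (f : R -> R) :
  \tr (mxfun f B) = (\sum_(x <- spectrum B) f x)%:C.
Proof.
rewrite big_spectrum /mxfun -mulmxA mxtrace_mulC mulmxK ?spectral_unit //.
by rewrite mxtrace_diag rmorph_sum; apply: eq_bigr => i _; rewrite mxE.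
Qed.

Lemma mxtrace_mxpowR n (B : 'M[C]_n) (p : R) : p != 0 ->
  \tr (mxpowR B p) = (\sum_(x <- spectrum B) x `^ p)%:C.
Proof. by rewrite /mxpowR => /negbTE ->; exact: mxtrace_mxfun. Qed.

(** As [p] decreases to [0], [x^p] tends to the indicator of [x != 0]: the trace
    is the rank. *)
Lemma mxtrace_mxpowR0 n (B : 'M[C]_n) : nonneg_definite B ->
  \tr (mxpowR B 0) = (\sum_(x <- spectrum B) (x != 0)%:R)%:C.
Proof.
move=> hB; rewrite /mxpowR eqxx -mxtrace_mxfun; congr (\tr _).
apply: lim_mxfun => i; apply: cvg_powR_support.
by rewrite -lecR -spectral_diagE // spectral_diag_ge0.
Qed.
End Traces.

Theorem corollary2 (R : realType) (m : nat) (A : 'M[R[i]]_m)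
    (hA : nonneg_definite A) (I J : {set 'I_m}) :
  (forall p : R, 0 <= p <= 1 ->
     \tr (mxpowR (principal_submx A (I :|: J)) p)
       + \tr (mxpowR (principal_submx A (I :&: J)) p)
     <= \tr (mxpowR (principal_submx A I) p)
       + \tr (mxpowR (principal_submx A J) p)) /\
  (forall p : R, 1 <= p <= 2 ->
     \tr (mxpowR (principal_submx A I) p)
       + \tr (mxpowR (principal_submx A J) p)
     <= \tr (mxpowR (principal_submx A (I :|: J)) p)
       + \tr (mxpowR (principal_submx A (I :&: J)) p)) /\
  \tr (mxxlogx (principal_submx A I)) + \tr (mxxlogx (principal_submx A J))
  <= \tr (mxxlogx (principal_submx A (I :|: J)))
     + \tr (mxxlogx (principal_submx A (I :&: J))).
Proof.
pose xs := spectrum (principal_submx A (I :|: J)) ++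
           spectrum (principal_submx A (I :&: J)).
pose ys := spectrum (principal_submx A I) ++ spectrum (principal_submx A J).
have psd K := principal_submx_psd K hA.
have nonneg (K L : {set 'I_m}) :
    {in spectrum (principal_submx A K) ++ spectrum (principal_submx A L),
       forall x, 0 <= x}.
  by move=> x; rewrite mem_cat => /orP[]; exact: spectrum_ge0.
have xs0 : {in xs, forall x, 0 <= x} := nonneg _ _.
have ys0 : {in ys, forall x, 0 <= x} := nonneg _ _.
have log_le := log_det_submodular hA I J.
have sum_eq := trace_modular hA I J.
have sum_powR1 (zs : seq R) : {in zs, forall x, 0 <= x} ->
    \sum_(x <- zs) x `^ 1 = \sum_(x <- zs) x.
  by move=> zs0; apply: eq_big_seq => x /zs0; exact: powRr1.
split; [|split].
- move=> p /andP[]; rewrite le_eqVlt => /predU1P[<- _|p0].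
    rewrite !mxtrace_mxpowR0 // -!rmorphD lecR -!big_cat.
    exact: (support_sum_le xs0 ys0 log_le).
  rewrite !mxtrace_mxpowR ?gt_eqF // -!rmorphD lecR -!big_cat.
  rewrite le_eqVlt => /predU1P[->|p1]; first by rewrite !sum_powR1 ?sum_eq.
  exact: (powR_sum_le01 xs0 ys0 log_le).
- move=> p /andP[p1 p2]; have p0 : 0 < p := lt_le_trans ltr01 p1.
  rewrite !mxtrace_mxpowR ?gt_eqF // -!rmorphD lecR -!big_cat.
  move: p1; rewrite le_eqVlt => /predU1P[<-|p1].
    by rewrite !sum_powR1 ?sum_eq.
  move: p2; rewrite le_eqVlt => /predU1P[->|p2].
    exact: (sqr_sum_le xs0 ys0 log_le sum_eq).
  exact: (powR_sum_le12 xs0 ys0 log_le sum_eq).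
- rewrite !mxtrace_mxfun -!rmorphD lecR -!big_cat.
  exact: (xlogx_sum_le xs0 ys0 log_le sum_eq).
Qed.
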